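(* Fix a constant $0<\alpha<1$. There exist constants $c>0$ and $n_0$ (depending only on $\alpha$) such that for all $n\ge n_0$, all $D$ with $2\le D\le \alpha n$, and all $k$ with $0<k\le D/2$: if a deterministic algorithm together with advice assignments accomplishes (even anonymous) topology recognition within time $D+k$ on every graph of size $n$ and diameter $D$, then the size of advice is at least $c(\log n)/k$. That is, the size of advice needed is in $\Omega((\log n)/k)$.
   Context: Graphs are finite, simple, undirected, connected, with no node labels; at each node of degree $d$ the incident edges carry distinct port numbers $0,\dots,d-1$ (no coherence between endpoints). Isomorphism is a bijection of nodes preserving edges and port numbers at both endpoints. Size = number of nodes; $\log$ is base 2. Communication model (LOCAL): synchronous rounds, all nodes start simultaneously; in each round every node may send arbitrary messages to all neighbours, receives their messages (knowing the arrival port), and performs arbitrary local computation. Initially a node knows only its degree and its advice. Advice: an oracle knowing the graph assigns each node a binary string (possibly different for different nodes); the size of advice is the maximum string length. All nodes run the same deterministic algorithm. Anonymous topology recognition: every node outputs a port-labeled graph isomorphic to $G$. Time is the number of rounds until all nodes have output. *)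

(* Defs.v *)
From mathcomp Require Import all_boot.
From Stdlib Require Import Reals.

Set Implicit Arguments.
Unset Strict Implicit.
Unset Printing Implicit Defensive.

(* A port-labeled graph on nodes 'I_n: an adjacency relation and, at every
   node v, a port number [port v u] for the edge towards the neighbour u
   (the value for non-neighbours is irrelevant). *)
Record pgraph (n : nat) := PGraph {
  adj : 'I_n -> 'I_n -> bool;
  port : 'I_n -> 'I_n -> nat
}.

Definition deg n (G : pgraph n) (v : 'I_n) : nat := #|[set u | adj G v u]|.

Fixpoint reach n (G : pgraph n) (k : nat) (u v : 'I_n) : bool :=
  match k with
  | 0 => u == v
  | k'.+1 => reach G k' u v || [exists w, reach G k' u w && adj G w v]
  end.

Definition connected n (G : pgraph n) : Prop :=
  forall u v, exists k, reach G k u v.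

Definition is_pgraph n (G : pgraph n) : Prop :=
  [/\ forall u v, adj G u v = adj G v u,
      forall v, ~~ adj G v v,
      forall v u w, adj G v u -> adj G v w -> port G v u = port G v w -> u = w,
      forall v u, adj G v u -> port G v u < deg G v
    & connected G].

Definition has_diameter n (G : pgraph n) (D : nat) : Prop :=
  (forall u v, reach G D u v) /\
  (exists u v, forall k, k < D -> ~~ reach G k u v).

Definition pg_iso n m (G : pgraph n) (H : pgraph m) : Prop :=
  exists f : 'I_n -> 'I_m,
    bijective f /\
    (forall u v, adj H (f u) (f v) = adj G u v) /\
    (forall u v, adj G u v -> port H (f u) (f v) = port G u v).

Definition any_pgraph := {m : nat & pgraph m}.

(* A deterministic LOCAL algorithm, the same at all nodes, with local states
   in S and messages in M.  A node starts knowing only its degree and advice;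
   in each round it sends a message on each port (depending on its state and
   the port), receives the messages together with their arrival ports
   ([None] on non-existing ports) and updates its state arbitrarily.
   [out s = Some H] means that a node in state s outputs H. *)
Record algorithm (S M : Type) := Algorithm {
  init : nat -> seq bool -> S;
  msg : S -> nat -> M;
  step : S -> (nat -> option M) -> S;
  out : S -> option any_pgraph
}.

Fixpoint run S M (A : algorithm S M) n (G : pgraph n) (adv : 'I_n -> seq bool)
    (r : nat) : 'I_n -> S :=
  match r with
  | 0 => fun v => init A (deg G v) (adv v)
  | r'.+1 => fun v =>
      let st := run A G adv r' in
      step A (st v)
        (fun p => match [pick u | adj G v u && (port G v u == p)] with
                  | Some u => Some (msg A (st u) (port G u v))
                  | None => None
                  end)
  end.

Definition outputs_at S M (A : algorithm S M) n (G : pgraph n)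
    (adv : 'I_n -> seq bool) (v : 'I_n) (r : nat) (H : any_pgraph) : Prop :=
  out A (run A G adv r v) = Some H /\
  forall r', r' < r -> out A (run A G adv r' v) = None.

Definition recognizes_within S M (A : algorithm S M) n (G : pgraph n)
    (adv : 'I_n -> seq bool) (T : nat) : Prop :=
  forall v, exists r H, r <= T /\ outputs_at A G adv v r H /\
                        pg_iso G (projT2 H).

Definition log2R (x : R) : R := (ln x / ln 2)%R.

(* Main.v *)
Require Import Defs.
From mathcomp Require Import all_boot perm zify.
From Stdlib Require Import FunctionalExtensionality.
From Stdlib Require Import Reals Lra.

Set Implicit Arguments.
Unset Strict Implicit.
Unset Printing Implicit Defensive.

(** Small [k] (k^2 <= n): a hub carries a tail of length D - k, ending in an
    observer, and m ~ n/k loops of length 2k + 1; the i-th loop leaves the hub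
    by port a_i and comes back by port b_j, where the matching of the a_i with
    the b_j is an arbitrary permutation.  Within D + k rounds the observer sees
    each loop from both of its ends but never sees a loop being closed, so its
    view is determined by the advice strings read off along the a-ports and
    along the b-ports, and only these can tell the m! graphs apart.  Comparing
    m! with the number of advice assignments gives log m = O(b k).

    Large [k] (k^2 > n): only b >= 1 is needed, i.e. two non-isomorphic graphs
    with a node that has the same view in both, without advice, up to depth
    3D/2.  Both graphs are long chains made of nine "sheets" which cover one and
    the same base graph (a path with two triangles at one end and a half-edge at the other), and they differ
    only by crossing over a pair of triangles near the far end; a walk from the
    observer that notices which sheet it is on has to travel to the far end and
    most of the way back, which takes more than 3D/2 steps. *)

(** * Port-labelled graphs given by neighbour lists *)

Section NeighbourLists.

Variables (U : eqType) (nb : U -> seq U).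

Record nb_wf (vs : seq U) : Prop := NbWf {
  nb_wf_uniq : {in vs, forall u, uniq (nb u)};
  nb_wf_sub : {in vs, forall u, {subset nb u <= vs}};
  nb_wf_sym : {in vs, forall u v, v \in nb u -> u \in nb v};
  nb_wf_irr : {in vs, forall u, u \notin nb u}
}.

Inductive dle (u : U) : nat -> U -> Prop :=
| dle0 r : dle u r u
| dleS r v w : dle u r v -> w \in nb v -> dle u r.+1 w.

Lemma dle_mono u v r r' : dle u r v -> r <= r' -> dle u r' v.
Proof.
move=> d; elim: d r' => {r v} [r r' _|r v w _ IH vw [|r'] // le_rr']; first exact: dle0.
exact: dleS (IH _ le_rr') vw.
Qed.

Lemma dle_trans u v w r s : dle u r v -> dle v s w -> dle u (r + s) w.
Proof.
move=> duv; elim=> {w s} [s|s x w _ IH xw].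
  exact: dle_mono duv (leq_addr _ _).
by rewrite addnS; apply: dleS IH xw.
Qed.

Lemma dle1 u v : v \in nb u -> dle u 1 v.
Proof. exact: dleS (dle0 _ _). Qed.

Lemma dle_sym vs u v r : nb_wf vs -> u \in vs -> dle u r v ->
  v \in vs /\ dle v r u.
Proof.
move=> wf u_vs; elim=> {v r} [r|r v w _ [v_vs IH] vw]; first by split=> //; exact: dle0.
split; first exact: nb_wf_sub wf _ v_vs _ vw.
by rewrite -add1n; apply: dle_trans (dle1 (nb_wf_sym wf v_vs vw)) IH.
Qed.

Lemma dle_iter (m : nat -> U) (a b : nat) :
  (forall p, a <= p < b -> m p.+1 \in nb (m p)) -> a <= b ->
  dle (m a) (b - a) (m b).
Proof.
elim: b => [|b IH] hm ab; first by move: ab; rewrite leqn0 => /eqP->; exact: dle0.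
move: ab; rewrite leq_eqVlt => /predU1P[->|ab]; first by exact: dle0.
rewrite subSn //; apply: dleS; last by apply: hm; rewrite -ltnS ab /=.
by apply: IH => // p /andP[ap pb]; apply: hm; rewrite ap ltnW.
Qed.

Variables (n : nat) (vs : n.-tuple U).

Definition lgraph : pgraph n :=
  PGraph (fun i j => tnth vs j \in nb (tnth vs i))
         (fun i j => index (tnth vs j) (nb (tnth vs i))).

Hypotheses (uniq_vs : uniq vs) (wf : nb_wf vs).

Lemma tnth_vs_inj : injective (tnth vs).
Proof. exact/tuple_uniqP. Qed.

Lemma deg_lgraph i : deg lgraph i = size (nb (tnth vs i)).
Proof.
have u_vs := mem_tnth i vs.
rewrite /deg cardE -(size_map (tnth vs)); apply: perm_size; apply: uniq_perm.
- by rewrite (map_inj_uniq tnth_vs_inj) enum_uniq.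
- exact: nb_wf_uniq wf _ u_vs.
move=> v; apply/mapP/idP => [[j]|vi]; first by rewrite mem_enum inE => ij ->.
have /tnthP[j vj] := nb_wf_sub wf u_vs vi.
by exists j; rewrite // mem_enum inE /= -vj.
Qed.

Lemma dle_reach i j r : dle (tnth vs i) r (tnth vs j) -> reach lgraph r i j.
Proof.
move: {2}(tnth vs j) (erefl (tnth vs j)) => v vj; rewrite vj => d.
elim: d j vj => {v r} [r|r v w dv IH vw] j vj.
  have -> := tnth_vs_inj vj; elim: r => //= r IH.
  by rewrite IH.
have [v_vs _] := dle_sym wf (mem_tnth i vs) dv.
have /tnthP[l vl] := v_vs.
by rewrite /=; apply/orP; right; apply/existsP; exists l; rewrite IH //= -vl vj.
Qed.

Lemma lgraph_is_pgraph r :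
  {in vs &, forall u v, dle u r v} -> is_pgraph lgraph.
Proof.
move=> conn; split=> [i j|i|i j l|i j|i j] /=.
- by apply/idP/idP; apply: (nb_wf_sym wf); apply: mem_tnth.
- exact: nb_wf_irr wf _ (mem_tnth i vs).
- by move=> ij il /(congr1 (nth (tnth vs i) (nb (tnth vs i))));
    rewrite !nth_index // => /tnth_vs_inj.
- by rewrite deg_lgraph index_mem.
- by exists r; apply/dle_reach/conn; apply: mem_tnth.
Qed.

Lemma lipschitz_reach (pos : U -> nat) i j r :
  {in vs, forall u v, v \in nb u -> pos v <= (pos u).+1} ->
  reach lgraph r i j -> pos (tnth vs j) <= pos (tnth vs i) + r.
Proof.
move=> lip; elim: r j => [|r IH] j /=; first by move/eqP->; rewrite addn0.
case/orP=> [/IH|/existsP[l /andP[/IH il lj]]]; first by lia.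
by have := lip _ (mem_tnth l vs) _ lj; lia.
Qed.

(** The potential [pos] rises by at most one along an edge, so its gap between [u0] and [v0] bounds
    their distance from below. *)
Lemma lgraph_diameter (pos : U -> nat) D u0 v0 :
  {in vs &, forall u v, dle u D v} ->
  {in vs, forall u v, v \in nb u -> pos v <= (pos u).+1} ->
  u0 \in vs -> v0 \in vs -> pos u0 + D <= pos v0 ->
  has_diameter lgraph D.
Proof.
move=> conn lip /tnthP[i ->] /tnthP[j ->] far; split=> [i' j'|].
  by apply/dle_reach/conn; apply: mem_tnth.
exists i, j => k kD; apply/negP => /(lipschitz_reach lip); lia.
Qed.

End NeighbourLists.

(** Ports of [lgraph] are positions in neighbour lists, so a pair in [zip (nb u) (nb' u')] consists
    of the nodes behind one and the same port of [u] and [u']. *)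
Lemma zip_uniq_index (U : eqType) (s s' : seq U) v v' :
  uniq s -> uniq s' -> size s = size s' -> (v, v') \in zip s s' ->
  [/\ v \in s, v' \in s' & index v s = index v' s'].
Proof.
move=> us us' ss /(nthP (v, v'))[p]; rewrite size_zip -ss minnn => ps.
rewrite nth_zip // => -[<- <-].
by rewrite !mem_nth -?ss // !index_uniq -?ss.
Qed.

Lemma zip_memr (U : eqType) (s s' : seq U) v :
  v \in s -> size s = size s' -> exists v', (v, v') \in zip s s'.
Proof.
move=> vs ss; exists (nth v s' (index v s)).
apply/(nthP (v, v)); exists (index v s).
  by rewrite size_zip -ss minnn index_mem.
by rewrite nth_zip // nth_index.
Qed.

Lemma zip_diag (U : eqType) (s : seq U) v v' :
  ((v, v') \in zip s s) = (v \in s) && (v == v').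
Proof.
elim: s => //= x s IH; rewrite !inE IH xpair_eqE.
by case: (v =P x) => [->|] //=; rewrite [v' == x]eq_sym; case: eqP; rewrite ?andbF ?andbT.
Qed.

(** * Indistinguishable runs *)

Section Simulation.

Variables (U : eqType) (n : nat) (vs : n.-tuple U) (nb nb' : U -> seq U).
Hypotheses (uniq_vs : uniq vs) (wf : nb_wf nb vs) (wf' : nb_wf nb' vs).

(* The second conjunct of the step condition says that the two edges also carry
   equal port numbers at their far ends. *)
Lemma run_simulation (R : nat -> U -> U -> Prop) S M (A : algorithm S M)
    (adv adv' : 'I_n -> seq bool) :
  (forall r u u', R r u u' -> size (nb u) = size (nb' u')) ->
  (forall r i i', R r (tnth vs i) (tnth vs i') -> adv i = adv' i') ->
  (forall r u u', R r.+1 u u' -> R r u u') ->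
  (forall r u u', u \in vs -> u' \in vs -> R r.+1 u u' ->
     forall v v', (v, v') \in zip (nb u) (nb' u') ->
     R r v v' /\ (u, u') \in zip (nb v) (nb' v')) ->
  forall r i i', R r (tnth vs i) (tnth vs i') ->
  run A (lgraph nb vs) adv r i = run A (lgraph nb' vs) adv' r i'.
Proof.
move=> Rsz Radv Rdec Rstep; elim=> [|r IH] i i' Rii'.
  by rewrite /= !deg_lgraph // (Rsz _ _ _ Rii') (Radv _ _ _ Rii').
rewrite /= (IH _ _ (Rdec _ _ _ Rii')); congr (step _ _ _).
have szE := Rsz _ _ _ Rii'.
have [u_vs u'_vs] := (mem_tnth i vs, mem_tnth i' vs).
have [un un'] := (nb_wf_uniq wf u_vs, nb_wf_uniq wf' u'_vs).
apply: functional_extensionality => p.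
case: pickP => [j /andP[ij /eqP pj]|none]; case: pickP => [j' /andP[ij' /eqP pj']|none'] //.
- have jj' : (tnth vs j, tnth vs j') \in zip (nb (tnth vs i)) (nb' (tnth vs i')).
    apply/(nthP (tnth vs j, tnth vs j')); exists p.
      by rewrite size_zip -szE minnn -pj index_mem.
    by rewrite nth_zip // -{1}pj -pj' !nth_index.
  have [Rjj' back] := Rstep _ _ _ u_vs u'_vs Rii' _ _ jj'.
  rewrite (IH _ _ Rjj'); congr (Some (msg _ _ _)) => /=.
  have [j_vs j'_vs] := (mem_tnth j vs, mem_tnth j' vs).
  by have [] := zip_uniq_index (nb_wf_uniq wf j_vs) (nb_wf_uniq wf' j'_vs)
    (Rsz _ _ _ Rjj') back.
(* Equal degrees rule out a port that exists on one side only. *)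
- have [v' jv'] := zip_memr ij szE.
  have [_ v'i' idx] := zip_uniq_index un un' szE jv'.
  have /tnthP[j' v'E] := nb_wf_sub wf' u'_vs v'i'.
  by have := none' j'; rewrite /= -v'E v'i' -idx -pj eqxx.
- have szE' : size (nb' (tnth vs i')) = size (nb (tnth vs i)) by rewrite szE.
  have [v jv] := zip_memr ij' szE'.
  have [_ vi idx] := zip_uniq_index un' un szE' jv.
  have /tnthP[j vE] := nb_wf_sub wf u_vs vi.
  by have := none j; rewrite /= -vE vi -idx -pj' eqxx.
Qed.

(** Isomorphisms are rigid: since ports are preserved, the image of one node dictates the images of
    its neighbours. *)
Lemma iso_follow f i i' v v' :
  (forall i j, adj (lgraph nb' vs) (f i) (f j) = adj (lgraph nb vs) i j) ->
  (forall i j, adj (lgraph nb vs) i j ->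
     port (lgraph nb' vs) (f i) (f j) = port (lgraph nb vs) i j) ->
  size (nb (tnth vs i)) = size (nb' (tnth vs i')) ->
  f i = i' -> (v, v') \in zip (nb (tnth vs i)) (nb' (tnth vs i')) ->
  exists j j', [/\ v = tnth vs j, v' = tnth vs j' & f j = j'].
Proof.
move=> fadj fport szE fi vv'.
have [u_vs u'_vs] := (mem_tnth i vs, mem_tnth i' vs).
have [vi v'i' idx] := zip_uniq_index (nb_wf_uniq wf u_vs) (nb_wf_uniq wf' u'_vs) szE vv'.
have /tnthP[j vE] := nb_wf_sub wf u_vs vi.
have /tnthP[j' v'E] := nb_wf_sub wf' u'_vs v'i'.
exists j, j'; split=> //.
have ij : adj (lgraph nb vs) i j by rewrite /= -vE.
have := fport _ _ ij; have := fadj i j; rewrite ij fi /= -vE => fij' pE.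
apply: (tnth_vs_inj uniq_vs).
by rewrite -v'E -(nth_index (tnth vs i) fij') pE idx nth_index.
Qed.

End Simulation.

(** * Isomorphism, outputs and triangles *)

Lemma pg_iso_sym n m (G : pgraph n) (H : pgraph m) : pg_iso G H -> pg_iso H G.
Proof.
case=> f [[g fK gK] [fadj fport]]; exists g; split; first by exists f.
split=> u v; first by rewrite -fadj !gK.
by move=> uv; rewrite -fport ?gK // -fadj !gK.
Qed.

Lemma pg_iso_trans n m p (G : pgraph n) (H : pgraph m) (K : pgraph p) :
  pg_iso G H -> pg_iso H K -> pg_iso G K.
Proof.
case=> f [fbij [fadj fport]] [g [gbij [gadj gport]]].
exists (g \o f); split; first exact: bij_comp.
split=> u v /=; first by rewrite gadj fadj.
by move=> uv; rewrite gport ?fadj // fport.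
Qed.

(** A node with equal states in both runs first outputs in the same round and outputs one graph,
    which is isomorphic to [G] and to [H]. *)
Lemma recognizes_iso S M (A : algorithm S M) n (G H : pgraph n)
    (adv adv' : 'I_n -> seq bool) T v :
  recognizes_within A G adv T -> recognizes_within A H adv' T ->
  (forall r, r <= T -> run A G adv r v = run A H adv' r v) -> pg_iso G H.
Proof.
move=> recG recH runE.
have [r [K [rT [[outK noK] isoK]]]] := recG v.
have [r' [K' [rT' [[outK' noK'] isoK']]]] := recH v.
have rr' : r = r'.
  case: (ltngtP r r') => // lt.
  - by move: (noK' _ lt); rewrite -runE // outK.
  - by move: (noK _ lt); rewrite runE // outK'.
move: outK'; rewrite -rr' -runE // outK => -[KE].
by apply: pg_iso_trans isoK _; apply: pg_iso_sym; rewrite KE.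
Qed.

Definition triangles n (G : pgraph n) : {set 'I_n * 'I_n * 'I_n} :=
  [set t | [&& adj G t.1.1 t.1.2, adj G t.1.2 t.2 & adj G t.2 t.1.1]].

(** An isomorphism would inject [triangles G] into the smaller set [triangles H]. *)
Lemma triangles_not_iso n (G H : pgraph n) :
  triangles H \proper triangles G -> ~ pg_iso G H.
Proof.
move=> /proper_card ltHG [f [/bij_inj finj [fadj _]]].
pose F t := (f t.1.1, f t.1.2, f t.2).
have Finj : injective F by move=> [[a b] c] [[a' b'] c'] [/finj-> /finj-> /finj->].
have sub : F @: triangles G \subset triangles H.
  by apply/subsetP => _ /imsetP[t tG ->]; move: tG; rewrite !inE /= !fadj.
by move: (subset_leq_card sub); rewrite card_imset // leqNgt ltHG.
Qed.

(** * Two graphs with a common view up to depth 3D/2 *)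

Section Chain.

Variables (s P l : nat).

(* [inl (h, o, x)] lies on sheet (h, o): [x = 0] is the apex of its two
   triangles, [x <= s] runs along its path, [x = s+1 .. s+4] are the remaining
   triangle corners.  [inr j] is the tail node at distance [j] from the observer
   [inr 0] if [j < P], and otherwise a leaf hanging on [inr 1]. *)
Definition cnode : eqType := ((nat * bool * nat) + nat)%type.

Definition joined (h : nat) (o : bool) : cnode :=
  if o then inl (h.+1, false, s)
  else if h is h'.+1 then inl (h', true, s) else inr P.-1.

(* Two triangles at apexes (h, o) and (h, ~~ o) become a hexagon when a corner of
   each is joined to the other sheet: [mate] does so for the first triangles of
   all pairs of sheets, [mate'] for the second triangles of the pair h = 3, and
   only in the graph with [e = true]. *)
Definition mate (h : nat) (o : bool) : bool := if h == 4 then o else ~~ o.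

Definition mate' (e : bool) (h : nat) (o : bool) : bool :=
  if e && (h == 3) then ~~ o else o.

Definition chain_nb (e : bool) (u : cnode) : seq cnode :=
  match u with
  | inl (h, o, x) =>
      if x == 0 then [:: inl (h, o, 1); inl (h, o, s + 1); inl (h, o, s + 2);
                         inl (h, o, s + 3); inl (h, o, s + 4)]
      else if x < s then [:: inl (h, o, x.-1); inl (h, o, x.+1)]
      else if x == s then [:: inl (h, o, x.-1); joined h o]
      else [:: inl (h, o, 0);
               if x == s + 1 then inl (h, mate h o, s + 2)
               else if x == s + 2 then inl (h, mate h o, s + 1)
               else if x == s + 3 then inl (h, mate' e h o, s + 4)
               else inl (h, mate' e h o, s + 3)]
  | inr j =>
      if (j == 0) || (P <= j) then [:: inr 1]
      else (if j == P.-1 then inl (0, false, s) else inr j.+1) :: inr j.-1 ::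
           (if j == 1 then [seq inr i | i <- iota P l] else [::])
  end.

(** * Nodes, edges and diameter of the chains *)

Definition sheets : seq (nat * bool) :=
  [:: (0, false); (0, true); (1, false); (1, true); (2, false); (2, true);
      (3, false); (3, true); (4, false)].

Definition chain_nodes : seq cnode :=
  [seq inl (ho, x) | ho <- sheets, x <- iota 0 (s + 5)] ++ [seq inr j | j <- iota 0 (P + l)].

Lemma size_chain_nodes : size chain_nodes = 9 * (s + 5) + P + l.
Proof. by rewrite size_cat size_allpairs size_map !size_iota addnA. Qed.

Lemma mem_sheets h o : ((h, o) \in sheets) = (h + o <= 4).
Proof. by case: o; rewrite !inE !xpair_eqE /=; lia. Qed.

Lemma mem_chain_inl h o x : (inl (h, o, x) \in chain_nodes) = (h + o <= 4) && (x < s + 5).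
Proof.
rewrite mem_cat; have -> : (inl (h, o, x) : cnode) \in [seq inr j | j <- iota 0 (P + l)] = false.
  by apply/mapP => -[].
rewrite orbF -mem_sheets; apply/allpairsP/andP => [[[ho y] /= [hos ys [hoE xE]]]|[ho xs]].
  by move: ys; rewrite mem_iota hoE xE hos.
by exists ((h, o), x); rewrite mem_iota.
Qed.

Lemma mem_chain_inr j : (inr j \in chain_nodes) = (j < P + l).
Proof.
rewrite mem_cat; have -> : (inr j : cnode) \in [seq inl (ho, x) | ho <- sheets, x <- iota 0 (s + 5)] = false.
  by apply/allpairsP => -[[ho x] []].
by rewrite /= mem_map ?mem_iota // => ? ? [].
Qed.

Lemma uniq_chain_nodes : uniq chain_nodes.
Proof.
rewrite cat_uniq; apply/and3P; split.
- by apply: allpairs_uniq; rewrite ?iota_uniq // => -[a b] [c d] _ _ /= [-> ->].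
- by apply/hasPn => _ /mapP[j _ ->]; apply/allpairsP => -[[ho x] []].
- by rewrite map_inj_uniq ?iota_uniq // => ? ? [].
Qed.

(** A lower bound on the distance from the observer [inr 0], exact along [chain_line]. The values at
    triangle corners are low enough to serve both graphs. *)
Definition chain_pos (u : cnode) : nat :=
  match u with
  | inl (h, o, x) =>
      P + h * (2 * s + 4) +
      (if o then (if x <= s then s + 3 + x else s + 2)
       else (if x <= s then s - x else s + 1))
  | inr j => if j < P then j else 0
  end.

Lemma cnode_eqE :
  ((forall a b, (inl a == inl b :> cnode) = (a == b)) *
   (forall a j, (inl a == inr j :> cnode) = false) *
   (forall a j, (inr j == inl a :> cnode) = false) *
   (forall i j, (inr i == inr j :> cnode) = (i == j)))%type.
Proof. by []. Qed.

Lemma mem_leaves j : ((inr j : cnode) \in [seq inr i | i <- iota P l]) = (P <= j < P + l).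
Proof. by rewrite mem_map ?mem_iota // => ? ? []. Qed.

Lemma mem_leaves_inl a : ((inl a : cnode) \in [seq inr i | i <- iota P l]) = false.
Proof. by apply/mapP => -[]. Qed.

Definition chain_memE :=
  (in_cons, in_nil, eqxx, cnode_eqE, xpair_eqE, mem_leaves, mem_leaves_inl,
   mem_chain_inl, mem_chain_inr).

Lemma mem_if_seq (c : bool) (t t' : seq cnode) v :
  (v \in (if c then t else t')) = if c then v \in t else v \in t'.
Proof. by case: c. Qed.

Hypotheses (s_gt0 : 0 < s) (P_gt2 : 2 < P).

Ltac chain_ifs :=
  rewrite /= ?chain_memE /=; try lia;
  repeat (let E := fresh "E" in case: ifP => E; rewrite /= ?chain_memE /=; try lia).

Lemma chain_uniq e : {in chain_nodes, forall u, uniq (chain_nb e u)}.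
Proof.
case=> [[[h o] x]|j]; rewrite chain_memE => uv.
  rewrite /= /joined; case: o uv => uv; case: h uv => [|h] uv; chain_ifs.
rewrite /=; chain_ifs; rewrite ?mem_if_seq; chain_ifs.
rewrite map_inj_uniq ?iota_uniq => [|? ? []//]; rewrite (eqP E1) /=; chain_ifs.
Qed.

Lemma chain_sub e : {in chain_nodes, forall u, {subset chain_nb e u <= chain_nodes}}.
Proof.
case=> [[[h o] x]|j]; rewrite chain_memE => uv [[[h' o'] x']|j']; rewrite chain_memE /=.
- rewrite /joined /mate /mate'; case: o uv => uv; case: h uv => [|h] uv; chain_ifs.
- rewrite /joined /mate /mate'; case: o uv => uv; case: h uv => [|h] uv; chain_ifs.
- chain_ifs; rewrite ?mem_if_seq; chain_ifs.
- chain_ifs; rewrite ?mem_if_seq; chain_ifs.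
Qed.

Ltac chain_cases := rewrite ?in_cons ?in_nil ?orbF;
  repeat match goal with
  | |- is_true (_ || _) -> _ => case/orP
  | |- is_true (_ == _) -> _ => move/eqP->
  end.

Lemma mateK h o : mate h (mate h o) = o.
Proof. by rewrite /mate; case: o; case: (h == 4). Qed.

Lemma mate'K e h o : mate' e h (mate' e h o) = o.
Proof. by rewrite /mate'; case: o; case: (_ && _). Qed.

Lemma chain_sym e : {in chain_nodes, forall u v, v \in chain_nb e u -> u \in chain_nb e v}.
Proof.
case=> [[[h o] x]|j]; rewrite chain_memE => uv v.
  rewrite {1}/chain_nb; case: ifP => E; first (chain_cases; chain_ifs).
  case: ifP => E1; first (chain_cases; chain_ifs).
  case: ifP => E2; first (rewrite /joined; case: o uv => uv; case: h uv => [|h] uv; chain_cases; chain_ifs).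
  by repeat case: ifP => ?; chain_cases; rewrite /= ?mateK ?mate'K; chain_ifs.
rewrite {1}/chain_nb; case: ifP => E; first (chain_cases; chain_ifs; rewrite mem_if_seq; chain_ifs).
rewrite in_cons => /predU1P[->|].
  chain_ifs; rewrite ?mem_if_seq; chain_ifs.
rewrite in_cons => /predU1P[->|].
  chain_ifs; rewrite ?mem_if_seq; chain_ifs.
case: ifP => // /eqP -> /mapP[i iP ->]; move: iP; rewrite mem_iota => iP; chain_ifs.
Qed.

Lemma chain_irr e : {in chain_nodes, forall u, u \notin chain_nb e u}.
Proof.
case=> [[[h o] x]|j]; rewrite chain_memE => uv.
  rewrite /= /joined; case: o uv => uv; case: h uv => [|h] uv; chain_ifs.
by rewrite /=; chain_ifs; rewrite ?mem_if_seq; chain_ifs.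
Qed.

Lemma chain_wf e : nb_wf (chain_nb e) chain_nodes.
Proof.
split; [exact: chain_uniq|exact: chain_sub|exact: chain_sym|exact: chain_irr].
Qed.

Lemma chain_lip e : {in chain_nodes, forall u v, v \in chain_nb e u ->
  chain_pos v <= (chain_pos u).+1}.
Proof.
case=> [[[h o] x]|j]; rewrite chain_memE => uv v.
  rewrite {1}/chain_nb /mate /mate' /joined; case: ifP => E; first (case: o uv => uv; chain_cases; chain_ifs).
  case: ifP => E1; first (case: o uv => uv; chain_cases; chain_ifs).
  case: ifP => E2; first (case: o uv => uv; case: h uv => [|h] uv; chain_cases; chain_ifs).
  by repeat case: ifP => ?; case: o uv => uv; chain_cases; chain_ifs.
rewrite {1}/chain_nb; case: ifP => E; first (chain_cases; chain_ifs).
rewrite in_cons => /predU1P[->|].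
  chain_ifs.
rewrite in_cons => /predU1P[->|].
  chain_ifs.
case: ifP => // /eqP -> /mapP[i iP ->]; move: iP; rewrite mem_iota => iP; chain_ifs.
Qed.

(** The r-th node on the way through the pair of sheets [h]: down to the first apex, across the
    crossed first triangles, and up from the second apex. *)
Definition chain_line_at (h r : nat) : cnode :=
  if r <= s then inl (h, false, s - r)
  else if r == s + 1 then inl (h, false, s + 1)
  else if r == s + 2 then inl (h, true, s + 2)
  else inl (h, true, r - (s + 3)).

Definition chain_line (p : nat) : cnode :=
  if p < P then inr p
  else chain_line_at ((p - P) %/ (2 * s + 4)) ((p - P) %% (2 * s + 4)).

Definition chain_diam : nat := P + 9 * s + 17.

Lemma chain_lineE h r : r < 2 * s + 4 ->
  chain_line (P + h * (2 * s + 4) + r) = chain_line_at h r.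
Proof.
move=> rM; rewrite /chain_line -addnA ltnNge leq_addr /= addKn.
by rewrite divnMDl ?modnMDl ?divn_small ?modn_small ?addn0 //; lia.
Qed.

Lemma chain_line_step e p : p < chain_diam ->
  chain_line p.+1 \in chain_nb e (chain_line p).
Proof.
move=> pD; have [pP|Pp] := ltnP p P.
  have [pP'|Pp'] := ltnP p.+1 P; first by rewrite /chain_line pP pP'; chain_ifs.
  have -> : p.+1 = P + 0 * (2 * s + 4) + 0 by lia.
  rewrite chain_lineE; last by lia.
  by rewrite /chain_line /chain_line_at pP; chain_ifs.
have [h [r [rM pE]]] : exists h r, r < 2 * s + 4 /\ p = P + h * (2 * s + 4) + r.
  exists ((p - P) %/ (2 * s + 4)), ((p - P) %% (2 * s + 4)).
  by rewrite ltn_mod -addnA -divn_eq; lia.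
have hr : (h < 4) || (h == 4) && (r <= s) by move: pD; rewrite pE /chain_diam; nia.
have [rM'|Mr] := ltnP r.+1 (2 * s + 4).
  rewrite pE -addnS !chain_lineE // /chain_line_at.
  by rewrite /chain_nb /joined /mate; chain_ifs.
have -> : p.+1 = P + h.+1 * (2 * s + 4) + 0 by lia.
rewrite pE !chain_lineE //; last by lia.
by rewrite /chain_nb /chain_line_at /joined /mate; chain_ifs.
Qed.

(** Off the line there are only leaves, which hang on position 1, and triangle corners, which hang
    on an apex. *)
Lemma chain_near_line e u : u \in chain_nodes -> exists p, p <= chain_diam /\
  (u = chain_line p \/ 0 < p < chain_diam /\ u \in chain_nb e (chain_line p)).
Proof.
case: u => [[[h o] x]|j]; rewrite chain_memE => uv; last first.
  have [jP|Pj] := ltnP j P; first by exists j; split; [rewrite /chain_diam; lia|left; rewrite /chain_line jP].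
  exists 1; split; [rewrite /chain_diam; lia|right].
  rewrite /chain_line; have -> : 1 < P by lia.
  by split; [rewrite /chain_diam; lia|chain_ifs].
have [xs|sx] := leqP x s.
  exists (P + h * (2 * s + 4) + if o then s + 3 + x else s - x); split.
    by rewrite /chain_diam; case: o uv; nia.
  by left; rewrite chain_lineE /chain_line_at; case: o uv => uv; chain_ifs; congr inl; congr pair; lia.
have hD r : h + o <= 4 -> r <= (if o then 2 * s + 3 else s) -> P + h * (2 * s + 4) + r < chain_diam.
  by rewrite /chain_diam; case: o uv; nia.
have [xA|xA] := boolP (x == if o then s + 2 else s + 1).
  exists (P + h * (2 * s + 4) + x); split.
    by rewrite /chain_diam; case: o xA uv {hD}; nia.
  by left; rewrite chain_lineE /chain_line_at; case: o uv xA {hD} => uv xA; chain_ifs; rewrite (eqP xA); congr inl; congr pair; lia.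
exists (P + h * (2 * s + 4) + if o then s + 3 else s); have lt := hD (if o then s + 3 else s).
split; first by apply/ltnW/lt; case: o uv {hD lt xA}; lia.
right; split; first by rewrite lt; case: o uv {hD lt xA}; lia.
rewrite chain_lineE /chain_line_at; last by case: o {uv hD lt xA}; lia.
by case: o uv xA {hD lt} => uv xA; chain_ifs.
Qed.

Lemma chain_line_mem p : p <= chain_diam -> chain_line p \in chain_nodes.
Proof.
elim: p => [_|p IH pD].
  by rewrite /chain_line; case: ifP => P0; rewrite ?mem_chain_inr; lia.
exact: nb_wf_sub (chain_wf true) _ (IH (ltnW pD)) _ (chain_line_step true pD).
Qed.

Lemma chain_conn e : {in chain_nodes &, forall u v, dle (chain_nb e) u chain_diam v}.
Proof.
move=> u v u_vs v_vs.
have wf := chain_wf e.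
have line p q : p <= q -> q <= chain_diam -> dle (chain_nb e) (chain_line p) (q - p) (chain_line q).
  move=> pq qD; apply: dle_iter => // i /andP[_ iq]; apply: chain_line_step; lia.
have [p [pD pu]] := chain_near_line e u_vs.
have [q [qD qv]] := chain_near_line e v_vs.
wlog pq : u v u_vs v_vs p q pD qD pu qv / p <= q.
  move=> W; have [pq|qp] := leqP p q; first exact: (W u v u_vs v_vs p q).
  by have [] := dle_sym wf v_vs (W v u v_vs u_vs q p qD pD qv pu (ltnW qp)).
(* The boolean counts as 0 or 1: a step off the line is paid only at an interior point, so even two
   of them fit into [chain_diam]. *)
have up : dle (chain_nb e) u (0 < p < chain_diam) (chain_line p).
  case: pu => [->|[pD' pu]]; first exact: dle0.
  by rewrite pD'; apply/dle1; apply: (nb_wf_sym wf) pu; apply: chain_line_mem.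
have vq : dle (chain_nb e) (chain_line q) (0 < q < chain_diam) v.
  case: qv => [->|[qD' qv]]; first exact: dle0.
  by rewrite qD'; apply: dle1.
apply: dle_mono (dle_trans (dle_trans up (line _ _ pq qD)) vq) _; lia.
Qed.

(** * Indistinguishability of the two chains *)

Ltac chain_zip_cases := rewrite /= ?chain_memE; repeat case/orP; try done;
  case/andP => /eqP ? /eqP ?; subst; (split; [by right|chain_ifs]).

(** The only nodes whose neighbour lists depend on [e]. *)
Definition crossing (u : cnode) : bool :=
  if u is inl (h, _, x) then (h == 3) && (s + 3 <= x) else false.

Lemma chain_nb_crossing e e' u : u \in chain_nodes -> ~~ crossing u ->
  chain_nb e u = chain_nb e' u.
Proof.
case: u => [[[h o] x]|j] //=; rewrite chain_memE => uv ncr.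
by rewrite /mate'; repeat case: ifP => ? //; lia.
Qed.

Lemma size_chain_nb e e' h o h' o' x :
  size (chain_nb e (inl (h, o, x))) = size (chain_nb e' (inl (h', o', x))).
Proof. by rewrite /=; repeat case: ifP => ?. Qed.

(* Away from the tail the two graphs look alike around any two nodes with the
   same [x], whatever their sheets. *)
Definition chain_rel (T r : nat) (u u' : cnode) : Prop :=
  (u = u' /\ r + chain_pos u <= T) \/
  match u, u' with
  | inl (h, o, x), inl (h', o', x') =>
      [/\ x = x', r + P <= chain_pos u & r + P <= chain_pos u']
  | _, _ => False
  end.

(** Crossing nodes have position at least [P + 7 * s + 13]. A view of depth [T] that gets there has,
    by the bound on [T], too little depth left to return to the tail, so from then on only the base
    graph shows. *)
Lemma chain_rel_step T r u u' : P + T <= 2 * (P + 7 * s + 13) ->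
  u \in chain_nodes -> u' \in chain_nodes -> chain_rel T r.+1 u u' ->
  forall v v', (v, v') \in zip (chain_nb false u) (chain_nb true u') ->
  chain_rel T r v v' /\ (u, u') \in zip (chain_nb false v) (chain_nb true v').
Proof.
move=> hT u_vs u'_vs rel.
have lip e w w' : w \in chain_nodes -> w' \in chain_nb e w ->
    chain_pos w' <= (chain_pos w).+1 /\ chain_pos w <= (chain_pos w').+1.
  have [L wf] := (@chain_lip e, chain_wf e).
  move=> w_vs ww'; split; first exact: (L _ w_vs _ ww').
  by apply: (L _ (nb_wf_sub wf w_vs ww')); exact: nb_wf_sym wf _ w_vs _ ww'.
(* An equal pair at a crossing node is moved to the second alternative; in the first one both graphs
   then have the same neighbour list at [u]. *)
have [[uu' [ru ncr]]|] : (u = u' /\ r.+1 + chain_pos u <= T /\ ~~ crossing u) \/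
  match u, u' with
  | inl (h, o, x), inl (h', o', x') =>
      [/\ x = x', r.+1 + P <= chain_pos u & r.+1 + P <= chain_pos u']
  | _, _ => False
  end.
- case: rel => [[uu' ru]|]; last by right.
  have [cru|ncr] := boolP (crossing u); last by left.
  right; rewrite -uu'; case: u cru ru {u_vs uu'} => [[[h o] x]|] //= /andP[/eqP-> sx] ru.
  have hr : r.+1 + P <= P + 3 * (2 * s + 4) +
    (if o then if x <= s then s + 3 + x else s + 2 else if x <= s then s - x else s + 1).
    by case: o ru; case: ifP => ? ru; lia.
  by split.
- move=> v v'; rewrite -uu' (chain_nb_crossing true false u_vs ncr) zip_diag.
  case/andP=> uv /eqP<-.
  have wf := chain_wf false.
  have v_vs := nb_wf_sub wf u_vs uv.
  have vu := nb_wf_sym wf u_vs uv.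
  have [pv _] := lip _ _ _ u_vs uv.
  split; first by left; split=> //; apply: leq_trans ru; rewrite addSnnS leq_add2l.
  (* A non-crossing neighbour of a crossing node is its apex, which comes first in both lists. *)
  have [crv|ncrv] := boolP (crossing v); last by rewrite (chain_nb_crossing true false v_vs ncrv) zip_diag vu eqxx.
  case: v crv vu {uv v_vs pv} => [[[h o] x]|] //= /andP[/eqP-> sx] vu; move: vu ncr.
  by chain_ifs; rewrite ?orbF => /orP[] /eqP->; chain_ifs.
case: u u_vs {rel} => [[[h o] x]|] // u_vs; case: u' u'_vs => [[[h' o'] x']|] // u'_vs.
move=> [xx']; rewrite -{}xx' in u'_vs *; move=> ru ru' v v' vv'.
have [wf wf'] := (chain_wf false, chain_wf true).
have [uv uv' _] := zip_uniq_index (nb_wf_uniq wf u_vs) (nb_wf_uniq wf' u'_vs) (size_chain_nb _ _ _ _ _ _ _) vv'.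
have [_ rv] := lip _ _ _ u_vs uv.
have [_ rv'] := lip _ _ _ u'_vs uv'.
have xlt : x < s + 5 by move: u_vs; rewrite chain_memE => /andP[].
have {lip uv uv' u_vs u'_vs wf wf'} pv : r + P <= chain_pos v by lia.
have {rv rv'} pv' : r + P <= chain_pos v' by lia.
move: vv'; rewrite {1 2}/chain_nb; case: ifP => [/eqP xE|x0]; first by rewrite xE; chain_zip_cases.
case: ifP => xs; first by chain_zip_cases.
case: ifP => [/eqP xE|x_s].
  (* The one sheet end joined to the tail has position [P] and is excluded by [r.+1 + P <= P]; all
     others are joined to another sheet end. *)
  rewrite xE; case: o o' {hT} ru ru' => [] [] ru ru'; case: h ru => [|h] ru; case: h' ru' => [|h'] ru'.
  all: try by (move: ru; rewrite xE /=; case: ifP; lia).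
  all: try by (move: ru'; rewrite xE /=; case: ifP; lia).
  all: rewrite /joined; try by chain_zip_cases.
by repeat case: ifP => ?; chain_zip_cases; rewrite ?mateK ?mate'K ?eqxx /=; lia.
Qed.

(** The edges that exist only for [e = true] lie on a hexagon and in no triangle. *)
Lemma chain_cross_triangle u v w : u \in chain_nodes -> v \in chain_nodes ->
  w \in chain_nodes ->
  v \in chain_nb true u -> w \in chain_nb true v -> u \in chain_nb true w ->
  v \in chain_nb false u.
Proof.
move=> u_vs v_vs w_vs.
have [cu|ncu] := boolP (crossing u); last by rewrite (chain_nb_crossing true false u_vs ncu).
move=> uv vw wu; move: uv vw wu (nb_wf_irr (chain_wf true) u_vs).
case: u cu u_vs => [[[h o] x]|] //= /andP[/eqP-> sx]; rewrite chain_memE => u_vs.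
have [-> -> ->] : [/\ (x == 0) = false, (x < s) = false & (x == s) = false] by split; lia.
have [-> ->] : (x == s + 1) = false /\ (x == s + 2) = false by split; lia.
rewrite in_cons => /predU1P[-> _ _ _|]; first by rewrite in_cons eqxx.
have [->|->] : x = s + 3 \/ x = s + 4 by lia.
all: case: o {u_vs}; chain_ifs; rewrite ?orbF => /eqP->; chain_ifs; rewrite ?orbF => /orP[] /eqP->; chain_ifs.
Qed.

Lemma chain_graphs_not_iso n (vs : n.-tuple cnode) : vs = chain_nodes :> seq _ ->
  ~ pg_iso (lgraph (chain_nb false) vs) (lgraph (chain_nb true) vs).
Proof.
move=> vsE; apply: triangles_not_iso.
have mem i : tnth vs i \in chain_nodes by rewrite -vsE mem_tnth.
apply/properP; split.
  apply/subsetP => -[[i j] k]; rewrite !inE /= => /and3P[ij jk ki].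
  apply/and3P; split.
  - exact: chain_cross_triangle ij jk ki.
  - exact: chain_cross_triangle jk ki ij.
  - exact: chain_cross_triangle ki ij jk.
(* The second triangle of sheet [(3, false)] is present for [e = false] only. *)
have node x : x < s + 5 -> exists i, tnth vs i = inl (3, false, x).
  move=> xs; have /tnthP[i ->] : (inl (3, false, x) : cnode) \in vs by rewrite memtE vsE chain_memE xs.
  by exists i.
have [i iE] := node 0 ltac:(lia).
have [j jE] := node (s + 3) ltac:(lia).
have [k kE] := node (s + 4) ltac:(lia).
exists (i, j, k); rewrite !inE /= iE jE kE; chain_ifs.
Qed.

End Chain.

(** A chain of diameter [D] without leaves has [D + 28] nodes, and leaves make up the rest. From
    [110 <= D] come [s >= 10] and [P <= 11]. *)
Lemma chain_ambiguous n D T : 110 <= D -> D + 28 <= n -> T <= D + D./2 ->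
  exists (G H : pgraph n) (v : 'I_n),
    [/\ is_pgraph G /\ has_diameter G D, is_pgraph H /\ has_diameter H D, ~ pg_iso G H
      & forall S M (A : algorithm S M) r, r <= T ->
          run A G (fun=> [::]) r v = run A H (fun=> [::]) r v].
Proof.
move=> D110 Dn TD.
(* The crossing must be more than halfway between the tail and depth D + D/2;
   this holds as soon as P <= s + 1. *)
pose s := (D - 20) %/ 9; pose P := 3 + (D - 20) %% 9.
have DE : D = P + 9 * s + 17 by rewrite /P /s; lia.
have Ps : P <= s + 1 by rewrite /P /s; lia.
have s_gt0 : 0 < s by rewrite /s; lia.
have P_gt2 : 2 < P by rewrite /P; lia.
pose l := n - (9 * (s + 5) + P).
have szE : size (chain_nodes s P l) == n.
  by rewrite size_chain_nodes /l; lia.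
move: s P l DE Ps s_gt0 P_gt2 szE => s P l DE Ps s_gt0 P_gt2 szE.
pose vs := Tuple szE.
have uniq_vs : uniq vs := uniq_chain_nodes s P l.
have wf e : nb_wf (chain_nb s P l e) vs := chain_wf l s_gt0 P_gt2 e.
have graph_ok e : is_pgraph (lgraph (chain_nb s P l e) vs) /\
    has_diameter (lgraph (chain_nb s P l e) vs) D.
  have conn : {in vs &, forall u v, dle (chain_nb s P l e) u D v}.
    by rewrite DE; exact: chain_conn.
  split; first exact: lgraph_is_pgraph conn.
  apply: (lgraph_diameter uniq_vs (wf e) (pos := chain_pos s P) (u0 := inr 0) (v0 := inl (4, false, s + 1))) => //.
  - exact: chain_lip.
  - by rewrite mem_chain_inr; lia.
  - by rewrite mem_chain_inl; lia.
  - by rewrite /= DE; case: ifP; case: ifP; lia.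
have /tnthP[v vE] : inr 0 \in vs by rewrite mem_chain_inr; lia.
exists (lgraph (chain_nb s P l false) vs), (lgraph (chain_nb s P l true) vs), v.
split=> //; first exact: chain_graphs_not_iso.
move=> S M A r rT.
apply: (run_simulation uniq_vs (wf false) (wf true) (R := chain_rel s P T)) => //.
- move=> q u u' [[<- _]|].
    case: u => [[[h o] x]|j] //; exact: size_chain_nb.
  by case: u => [[[h o] x]|j] //; case: u' => [[[h' o'] x']|j'] // [<- _ _]; exact: size_chain_nb.
- move=> q u u' [[<- qu]|]; first by left; split=> //; lia.
  by case: u => [[[h o] x]|j] //; case: u' => [[[h' o'] x']|j'] // [<- qu qu']; right; split=> //; lia.
- move=> q u u' u_vs u'_vs; apply: chain_rel_step => //; lia.
- left; split=> //; rewrite -vE /=. case: ifP; lia.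
Qed.

(** * Loops through a hub, closed up by a permutation *)

Section Loops.

Variables (k d l m : nat).

(* [(0, 0)] is the hub, [(0, j)] the tail node at distance [j] from it if
   [j <= d] and otherwise a leaf at the hub; [(i.+1, x)] is the x-th inner node
   of the i-th loop, which returns to the hub by the port of index [j] among the
   last m ports when [nth 0 p j = i]. *)
Definition lnode : eqType := (nat * nat)%type.

Definition loops_nb (p : seq nat) (u : lnode) : seq lnode :=
  match u with
  | (0, j) =>
      if j == 0 then
        (0, 1) :: [seq (0, i) | i <- iota d.+1 l] ++
        [seq (i.+1, 0) | i <- iota 0 m] ++ [seq (i.+1, k.*2.-1) | i <- p]
      else if j <= d then (0, j.-1) :: (if j < d then [:: (0, j.+1)] else [::])
      else [:: (0, 0)]
  | (i.+1, x) => [:: (if x == 0 then (0, 0) else (i.+1, x.-1));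
                     (if x == k.*2.-1 then (0, 0) else (i.+1, x.+1))]
  end.

(** * Nodes, edges and diameter of the loop graphs *)

Definition loops_nodes : seq lnode :=
  [seq (0, j) | j <- iota 0 (d.+1 + l)] ++ [seq (i.+1, x) | i <- iota 0 m, x <- iota 0 k.*2].

Lemma size_loops_nodes : size loops_nodes = d.+1 + l + m * k.*2.
Proof. by rewrite size_cat size_allpairs size_map !size_iota. Qed.

Lemma mem_map_pair0 (s : seq nat) (a b : nat) :
  ((a, b) \in [seq (0, i) | i <- s]) = (a == 0) && (b \in s).
Proof.
apply/mapP/andP => [[i si [-> ->]]|[/eqP-> bs]]; first by rewrite eqxx.
by exists b.
Qed.

Lemma mem_map_pairS (s : seq nat) (a b c : nat) :
  ((a, b) \in [seq (i.+1, c) | i <- s]) = [&& 0 < a, a.-1 \in s & b == c].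
Proof.
apply/mapP/and3P => [[i si [-> ->]]|[a0 sa /eqP->]]; first by rewrite eqxx.
by exists a.-1; rewrite ?prednK.
Qed.

Lemma mem_loops_nodes a b :
  ((a, b) \in loops_nodes) = if a == 0 then b < d.+1 + l else (a <= m) && (b < k.*2).
Proof.
rewrite mem_cat mem_map_pair0 mem_iota /=; case: a => [|a] /=.
  by rewrite orbC; case: allpairsP => // -[[i x] []].
apply/allpairsP/andP => [[[i x] /= [im xk [-> ->]]]|[am bk]].
  by move: im xk; rewrite !mem_iota.
by exists (a, b); rewrite !mem_iota.
Qed.

Lemma uniq_loops_nodes : uniq loops_nodes.
Proof.
rewrite cat_uniq; apply/and3P; split.
- by rewrite map_inj_uniq ?iota_uniq // => ? ? [].
- apply/hasPn => -[a b] /allpairsP[[i x] /= [_ _ [-> ->]]].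
  by apply/mapP => -[].
- by apply: allpairs_uniq; rewrite ?iota_uniq // => -[a b] [a' b'] _ _ /= [-> ->].
Qed.

Definition loops_memE :=
  (mem_loops_nodes, in_cons, in_nil, eqxx, xpair_eqE, mem_cat, mem_map_pair0,
   mem_map_pairS, mem_iota).

Hypotheses (k_gt0 : 0 < k) (kd : k <= d) (m_gt0 : 0 < m).

Ltac loops_ifs :=
  rewrite /= ?loops_memE /=; try lia;
  repeat (let E := fresh "E" in case: ifP => E; rewrite /= ?loops_memE /=; try lia).

Lemma loops_wf p : perm_eq p (iota 0 m) -> nb_wf (loops_nb p) loops_nodes.
Proof.
move=> pp; have pm i : (i \in p) = (i < m) by rewrite (perm_mem pp) mem_iota.
have up : uniq p by rewrite (perm_uniq pp) iota_uniq.
split.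
- case=> [[|i] x]; rewrite loops_memE /= => uv.
    case: ifP => x0; last by loops_ifs.
    rewrite cons_uniq !cat_uniq !map_inj_uniq ?iota_uniq ?up; try by move=> ? ? [].
    rewrite !mem_cat !mem_map_pair0 !mem_map_pairS mem_iota /=.
    apply/andP; split; first by lia.
    rewrite andbT /=; apply/andP; split.
      apply/hasPn => -[a b]; rewrite /= mem_cat mem_map_pairS mem_map_pairS mem_map_pair0; lia.
    apply/hasPn => -[a b]; rewrite /= mem_map_pairS mem_map_pairS; lia.
  by loops_ifs.
- case=> [[|i] x] uv [a b]; move: uv; rewrite !loops_memE /= => uv.
    by case: ifP => x0; rewrite ?loops_memE ?pm; loops_ifs.
  by loops_ifs.
- case=> [[|i] x] uv [[|a] b]; move: uv; rewrite !loops_memE /= => uv.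
  + case: ifP => x0; rewrite ?loops_memE ?pm /=; loops_ifs;loops_ifs.
  + case: ifP => x0; rewrite ?loops_memE ?pm /=; loops_ifs;loops_ifs.
  + loops_ifs; rewrite ?pm; loops_ifs.
  + loops_ifs.
- case=> [[|i] x]; rewrite loops_memE /= => uv.
    by case: ifP => x0; rewrite ?loops_memE ?pm; loops_ifs.
  by loops_ifs.
Qed.

(** The distance from the observer [(0, d)]. *)
Definition loops_pos (u : lnode) : nat :=
  match u with
  | (0, j) => if j <= d then d - j else d.+1
  | (i.+1, x) => d + minn x.+1 (k.*2 - x)
  end.

Lemma loops_lip p : perm_eq p (iota 0 m) -> {in loops_nodes, forall u v,
  v \in loops_nb p u -> loops_pos v <= (loops_pos u).+1}.
Proof.
move=> pp; have pm i : (i \in p) = (i < m) by rewrite (perm_mem pp) mem_iota.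
case=> [[|i] x] uv [[|a] b]; move: uv; rewrite !loops_memE /= => uv.
- by case: ifP => x0; rewrite ?loops_memE ?pm /=; loops_ifs.
- by case: ifP => x0; rewrite ?loops_memE ?pm /=; loops_ifs.
- by loops_ifs.
- by loops_ifs.
Qed.

(** The distance from the hub. *)
Definition loops_depth (u : lnode) : nat :=
  match u with
  | (0, j) => if j <= d then j else 1
  | (i.+1, x) => minn x.+1 (k.*2 - x)
  end.

Lemma loops_depthP p u : perm_eq p (iota 0 m) -> u \in loops_nodes ->
  dle (loops_nb p) (0, 0) (loops_depth u) u.
Proof.
move=> pp; have pm i : (i \in p) = (i < m) by rewrite (perm_mem pp) mem_iota.
case: u => [[|i] x]; rewrite loops_memE /= => uv.
  case: ifP => xd; last by apply: dle1; rewrite /= !loops_memE; lia.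
  have := @dle_iter _ (loops_nb p) (fun j => (0, j)) 0 x _ (leq0n x).
  by rewrite subn0; apply=> j jx; rewrite /= ; loops_ifs.
(* The loop is entered from its nearer end; index 0 of either walk is the hub. *)
rewrite /minn; case: ifP => _.
  have := @dle_iter _ (loops_nb p) (fun j => if j is j'.+1 then (i.+1, j') else (0, 0)) 0 x.+1 _ (leq0n _).
  by rewrite subn0; apply=> -[|j] jx; rewrite /= ?pm; loops_ifs.
have := @dle_iter _ (loops_nb p) (fun j => if j is j'.+1 then (i.+1, k.*2.-1 - j') else (0, 0)) 0 (k.*2 - x) _ (leq0n _).
have -> : k.*2 - x = (k.*2 - x.+1).+1 by lia.
have -> : k.*2.-1 - (k.*2 - x.+1) = x by lia.
rewrite subn0; apply=> -[|j] jx; rewrite /= ?pm; loops_ifs; rewrite ?pm; lia.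
Qed.

(** Going through the hub is short enough unless both nodes are deeper than [k]; then both lie on
    the tail, which joins them directly. *)
Lemma loops_conn p : perm_eq p (iota 0 m) ->
  {in loops_nodes &, forall u v, dle (loops_nb p) u (d + k) v}.
Proof.
move=> pp u v u_vs v_vs; have wf := loops_wf pp.
have hub_vs : (0, 0) \in loops_nodes by rewrite loops_memE.
have [_ uh] := dle_sym wf hub_vs (loops_depthP pp u_vs).
have hv := loops_depthP pp v_vs.
have [small|big] := leqP (loops_depth u + loops_depth v) (d + k).
  exact: dle_mono (dle_trans uh hv) small.
have tail w : w \in loops_nodes -> k < loops_depth w -> exists2 j, w = (0, j) & j <= d.
  case: w => [[|i] x]; rewrite loops_memE /=; last by rewrite /minn; case: ifP; lia.
  by case: ifP => xd _; [exists x|lia].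
have dep w : w \in loops_nodes -> loops_depth w <= d.
  case: w => [[|i] x]; rewrite loops_memE /=; last by rewrite /minn; case: ifP; lia.
  by case: ifP => xd _ //; lia.
have [du dv] := (dep u u_vs, dep v v_vs).
have [j uE jd] : exists2 j, u = (0, j) & j <= d by apply: tail => //; lia.
have [j' vE jd'] : exists2 j, v = (0, j) & j <= d by apply: tail => //; lia.
have line a b : a <= b -> b <= d -> dle (loops_nb p) (0, a) (d + k) (0, b).
  move=> ab bd; apply: (@dle_mono _ _ _ _ (b - a)); last by lia.
  by apply: (@dle_iter _ _ (fun j => (0, j))) => // i iab; rewrite /=; loops_ifs.
rewrite {}uE {}vE in u_vs v_vs *.
have [jj'|jj'] := leqP j j'; first exact: line.
by have [] := dle_sym wf v_vs (line _ _ (ltnW jj') jd).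
Qed.

(** The first alternative covers the tail, the leaves, and loops entered by their a-port; the second
    covers loops entered backwards by the j-th b-port. The bounds on [r] leave too few rounds to
    close a loop. *)
Definition loops_rel (p p' : seq nat) (r : nat) (u u' : lnode) : Prop :=
  (u = u' /\ match u with
             | (0, j) => if j <= d then r <= k.*2 + j else r < k.*2
             | (i.+1, x) => r + x < k.*2
             end) \/
  exists j x, [/\ j < m, u = ((nth 0 p j).+1, x), u' = ((nth 0 p' j).+1, x) & r <= x < k.*2].

Lemma zip_map2 (T : Type) (U : eqType) (f g : T -> U) (s : seq T) :
  zip (map f s) (map g s) = [seq (f x, g x) | x <- s].
Proof. by elim: s => //= x s ->. Qed.

Lemma zip_hub p p' : size p = m -> size p' = m ->
  zip (loops_nb p (0, 0)) (loops_nb p' (0, 0)) =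
  ((0, 1), (0, 1)) :: [seq ((0, i), (0, i)) | i <- iota d.+1 l] ++
   [seq ((i.+1, 0), (i.+1, 0)) | i <- iota 0 m] ++
   [seq (((nth 0 p j).+1, k.*2.-1), ((nth 0 p' j).+1, k.*2.-1)) | j <- iota 0 m].
Proof.
move=> sp sp' /=; congr cons.
rewrite !zip_cat ?size_map // !zip_map2; congr (_ ++ (_ ++ _)).
by rewrite -{1}(mkseq_nth 0 p) -{1}(mkseq_nth 0 p') /mkseq -!map_comp sp sp' zip_map2.
Qed.

Lemma loops_rel_step p p' r u u' : perm_eq p (iota 0 m) -> perm_eq p' (iota 0 m) ->
  u \in loops_nodes -> u' \in loops_nodes -> loops_rel p p' r.+1 u u' ->
  forall v v', (v, v') \in zip (loops_nb p u) (loops_nb p' u') ->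
  loops_rel p p' r v v' /\ (u, u') \in zip (loops_nb p v) (loops_nb p' v').
Proof.
move=> pp pp' u_vs u'_vs.
have sp : size p = m by rewrite (perm_size pp) size_iota.
have sp' : size p' = m by rewrite (perm_size pp') size_iota.
have hub := zip_hub sp sp'.
have hubE w w' : ((w, w') \in zip (loops_nb p (0, 0)) (loops_nb p' (0, 0))) =
    [|| (w == (0, 1)) && (w' == (0, 1)),
        (w, w') \in [seq ((0, i), (0, i)) | i <- iota d.+1 l],
        (w, w') \in [seq ((i.+1, 0), (i.+1, 0)) | i <- iota 0 m] |
        (w, w') \in [seq (((nth 0 p j).+1, k.*2.-1), ((nth 0 p' j).+1, k.*2.-1)) | j <- iota 0 m]].
  by rewrite hub in_cons xpair_eqE !mem_cat.
have nonhub w : w != (0, 0) -> loops_nb p w = loops_nb p' w by case: w => [[|i] [|x]].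
case=> [[<-]|].
  case: (u =P (0, 0)) => [uE rk v v'|/eqP nhub rk v v'].
    have {}rk : r < k.*2 by move: rk; rewrite uE /= addn0.
    rewrite uE hubE => /or4P[/andP[/eqP-> /eqP->]|/mapP[i]|/mapP[i]|/mapP[j]]; rewrite ?mem_iota.
    - by split; [left; split=> //=; case: ifP; lia|loops_ifs].
    - by move=> ii [-> ->]; split; [left; split=> //=; case: ifP; lia|loops_ifs].
    - by move=> ii [-> ->]; split; [left; split=> //; lia|loops_ifs].
    (* Leaving the hub by a b-port switches to the second alternative. *)
    - move=> ii [-> ->]; split; last by loops_ifs.
      by right; exists j, k.*2.-1; split=> //; lia.
  rewrite -(nonhub u nhub) zip_diag => /andP[uv /eqP<-].
  have vu := nb_wf_sym (loops_wf pp) u_vs uv.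
  split.
    left; split=> //; move: uv; case: u u_vs nhub rk {u'_vs vu} => [[|i] x]; rewrite loops_memE /= => u_vs.
      rewrite xpair_eqE /= => x0; rewrite (negbTE x0); case: v => [[|i] y]; rewrite ?mem_if_seq.
        by loops_ifs.
      by loops_ifs.
    by move=> _ rk; case: v => [[|i'] y]; loops_ifs.
  case: (v =P (0, 0)) => [vE|/eqP nv]; last by rewrite -nonhub // zip_diag vu eqxx.
  move: uv rk nhub; rewrite vE hubE; case: u u_vs {u'_vs vu} => [[|i] x]; rewrite loops_memE /= => u_vs.
    move=> uv _; rewrite !xpair_eqE /= => x0.
    have [xd|xd] := leqP x d; last by apply/or4P/Or42/map_f; rewrite mem_iota; lia.
    by move: uv; rewrite (negbTE x0) xd; loops_ifs.
  rewrite !in_cons in_nil => h1 h2 _; apply/or3P/Or32.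
  (* The other loop end next to the hub, [x = k.*2.-1], violates [r.+1 + x < k.*2]. *)
  have -> : x = 0 by move: h1 h2; rewrite /=; do 2!(case: ifP => ?); rewrite !xpair_eqE /=; lia.
  by apply: (map_f (fun i => ((i.+1, 0), (i.+1, 0)))); rewrite mem_iota; lia.
case=> j [x [jm uE uE' rx]] v v'.
(* Since [r.+1 <= x], a backward walk does not get out by the a-port. *)
have x0 : (x == 0) = false by lia.
rewrite uE uE' /= x0 !in_cons in_nil orbF => /orP[]; rewrite xpair_eqE => /andP[/eqP-> /eqP->].
  by split; [right; exists j, x.-1; split=> //; lia|loops_ifs].
have [xk|xk] := eqVneq x k.*2.-1; last by split; [right; exists j, x.+1; split=> //; lia|loops_ifs].
split; first by left; split=> //=; lia.
rewrite hubE xk; apply/or4P/Or44.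
by apply: (map_f (fun j => (((nth 0 p j).+1, k.*2.-1), ((nth 0 p' j).+1, k.*2.-1)))); rewrite mem_iota.
Qed.

(** * Rigidity of the loop graphs and the role of advice *)

Variables (n : nat) (vs : n.-tuple lnode).
Hypothesis vsE : vs = loops_nodes :> seq _.

Definition loops_graph (p : seq nat) : pgraph n := lgraph (loops_nb p) vs.

Lemma uniq_vs_loops : uniq vs.
Proof. by rewrite vsE uniq_loops_nodes. Qed.

Lemma loops_wf_vs p : perm_eq p (iota 0 m) -> nb_wf (loops_nb p) vs.
Proof. by move=> pp; rewrite vsE; exact: loops_wf. Qed.

Lemma loops_graph_ok p : perm_eq p (iota 0 m) ->
  is_pgraph (loops_graph p) /\ has_diameter (loops_graph p) (d + k).
Proof.
move=> pp; have [u w] := (uniq_vs_loops, loops_wf_vs pp).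
have conn : {in vs &, forall u v, dle (loops_nb p) u (d + k) v}.
  by move=> a b; rewrite !memtE vsE; exact: loops_conn.
split; first exact: lgraph_is_pgraph conn.
apply: (lgraph_diameter u w (pos := loops_pos) (u0 := (0, d)) (v0 := (1, k.-1))) => //.
- by move=> a; rewrite memtE vsE; exact: (loops_lip pp).
- by rewrite memtE vsE; loops_ifs.
- by rewrite memtE vsE; loops_ifs.
- by rewrite /= leqnn subnn /minn; case: ifP; lia.
Qed.

(** The isomorphism fixes the hub and, following a-ports, every loop node; its action on the j-th
    b-port then gives [nth 0 p j = nth 0 p' j]. *)
Lemma loops_iso_eq p p' : perm_eq p (iota 0 m) -> perm_eq p' (iota 0 m) ->
  pg_iso (loops_graph p) (loops_graph p') -> p = p'.
Proof.
move=> pp pp' [f [fbij [fadj fport]]].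
have finj := bij_inj fbij; have [[uv wf] wf'] := (uniq_vs_loops, loops_wf_vs pp, loops_wf_vs pp').
have sp : size p = m by rewrite (perm_size pp) size_iota.
have sp' : size p' = m by rewrite (perm_size pp') size_iota.
have size_nb u : size (loops_nb p u) = size (loops_nb p' u).
  by case: u => [[|i] x] //=; case: ifP => //= _; rewrite !size_cat !size_map sp sp'.
have fdeg i : size (loops_nb p' (tnth vs (f i))) = size (loops_nb p (tnth vs i)).
  rewrite -(deg_lgraph uv wf') -(deg_lgraph uv wf) /deg -[RHS](card_imset _ finj).
  apply: eq_card => j.
  have [g fK gK] := fbij.
  by rewrite -[j]gK mem_imset // !inE -fadj.
pose Fix u u' := exists i, u = tnth vs i /\ u' = tnth vs (f i).
have Fix_fun u u' u'' : Fix u u' -> Fix u u'' -> u' = u''.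
  by move=> [i [-> ->]] [j [/(tnth_vs_inj uv) -> ->]].
have follow u v v' : Fix u u -> (v, v') \in zip (loops_nb p u) (loops_nb p' u) -> Fix v v'.
  move=> [i [uE uE']]; have fi : f i = i by apply: (tnth_vs_inj uv); rewrite -uE' uE.
  rewrite uE => vv'.
  have [//|j [j' [-> -> <-]]] := iso_follow uv wf wf' fadj fport _ fi vv'; first by exists j.
(* The hub has degree at least 3, all other nodes at most 2. *)
have hub : Fix (0, 0) (0, 0).
  have /tnthP[i iE] : (0, 0) \in vs by rewrite memtE vsE loops_memE.
  exists i; split=> //; have := fdeg i; rewrite -iE.
  have := mem_tnth (f i) vs; rewrite memtE vsE.
  case: (tnth vs (f i)) => [[|a] [|b]] //= _; rewrite !size_cat !size_map !size_iota sp;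
    do ?case: ifP => _ /=; lia.
have loop i x : i < m -> x < k.*2 -> Fix (i.+1, x) (i.+1, x).
  move=> im; elim: x => [_|x IH xk].
    apply: follow hub _; rewrite zip_hub // in_cons !mem_cat.
    apply/or4P/Or43.
    by apply: (map_f (fun i => ((i.+1, 0), (i.+1, 0)))); rewrite mem_iota.
  by apply: follow (IH (ltnW xk)) _; loops_ifs.
apply: (@eq_from_nth _ 0) => [|j jp]; first by rewrite sp sp'.
have jm : j < m by rewrite -sp.
have pjm : nth 0 p j < m.
  by have := mem_nth 0 jp; rewrite (perm_mem pp) mem_iota.
have : Fix ((nth 0 p j).+1, k.*2.-1) ((nth 0 p' j).+1, k.*2.-1).
  apply: follow hub _; rewrite zip_hub // in_cons !mem_cat; apply/or4P/Or44.
  by apply: (map_f (fun j => (((nth 0 p j).+1, k.*2.-1), ((nth 0 p' j).+1, k.*2.-1)))); rewrite mem_iota.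
have lt : k.*2.-1 < k.*2 by lia.
by move=> /(Fix_fun _ _ _ (loop _ _ pjm lt)) [].
Qed.

(** Advice addressed by node label, empty off [vs], so that it composes with [relabel]. *)
Definition advice_of (adv : 'I_n -> seq bool) (u : lnode) : seq bool :=
  nth [::] [seq adv i | i <- enum 'I_n] (index u vs).

Lemma advice_ofE adv i : advice_of adv (tnth vs i) = adv i.
Proof.
rewrite /advice_of (tnth_nth (0, 0)) index_uniq ?uniq_vs_loops ?size_tuple //.
by rewrite (nth_map i) ?size_enum_ord // nth_ord_enum.
Qed.

(** Loops are renumbered by the b-port through which they return. *)
Definition relabel (p : seq nat) (u : lnode) : lnode :=
  match u with (0, j) => (0, j) | (i.+1, x) => ((nth 0 p i).+1, x) end.

(** The two advice hypotheses match the two alternatives of [loops_rel], so the observer [(0, d)] is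
    in the same state in both runs up to round [d + k.*2]. *)
Lemma loops_determined p p' S M (A : algorithm S M) (adv adv' : 'I_n -> seq bool) :
  perm_eq p (iota 0 m) -> perm_eq p' (iota 0 m) ->
  recognizes_within A (loops_graph p) adv (d + k.*2) ->
  recognizes_within A (loops_graph p') adv' (d + k.*2) ->
  {in vs, advice_of adv =1 advice_of adv'} ->
  {in vs, forall u, advice_of adv (relabel p u) = advice_of adv' (relabel p' u)} ->
  p = p'.
Proof.
move=> pp pp' rec rec' adv_eq adv_eq'; apply: loops_iso_eq => //.
have [[uv wf] wf'] := (uniq_vs_loops, loops_wf_vs pp, loops_wf_vs pp').
have sp : size p = m by rewrite (perm_size pp) size_iota.
have sp' : size p' = m by rewrite (perm_size pp') size_iota.
have /tnthP[v vE] : (0, d) \in vs by rewrite memtE vsE; loops_ifs.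
apply: (recognizes_iso (v := v) rec rec') => r rT.
apply: (run_simulation uv wf wf' (R := loops_rel p p')).
- move=> q u u' [[<- _]|[j [x [_ -> -> _]]]] //.
  by case: u => [[|i] x] //=; case: ifP => //= _; rewrite !size_cat !size_map sp sp'.
- move=> q i i'; rewrite -2!advice_ofE => -[[<- _]|[j [x [jm -> -> xk]]]].
    exact/adv_eq/mem_tnth.
  by apply: (adv_eq' (j.+1, x)); rewrite memtE vsE; loops_ifs.
- move=> q u u' [[<- qu]|[j [x [jm -> -> xk]]]].
    by left; split=> //; case: u qu => [[|i] x]; [case: ifP; lia|lia].
  by right; exists j, x; split=> //; lia.
- by move=> q u u'; rewrite !memtE vsE; exact: loops_rel_step.
- by left; rewrite -vE leqnn; split=> //; lia.
Qed.

End Loops.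

(** * Counting permutations against advice *)

Definition encode (b : nat) (w : seq bool) : {ffun 'I_b -> option bool} :=
  [ffun i : 'I_b => nth None (map Some w) i].

(** The padding by [None] records the length, so [3 ^ b] codes suffice for strings of length at most
    [b]. *)
Lemma encode_inj b w w' : size w <= b -> size w' <= b -> encode b w = encode b w' -> w = w'.
Proof.
move=> wb wb' /ffunP e.
have e' i : nth None (map Some w) i = nth None (map Some w') i.
  have [ib|bi] := ltnP i b; first by have := e (Ordinal ib); rewrite !ffunE.
  by rewrite !nth_default // size_map; lia.
have le_size x y : (forall i, nth None (map (@Some bool) x) i = nth None (map Some y) i) ->
    size y <= size x.
  move=> exy; rewrite leqNgt; apply/negP => lt; have := exy (size x).
  by rewrite nth_default ?size_map // (nth_map false).
have sz : size w = size w' by apply/eqP; rewrite eqn_leq !le_size.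
apply: (@eq_from_nth _ false) => // i iw; have := e' i.
by rewrite (nth_map false) // (nth_map false) -?sz // => -[].
Qed.

(** By [loops_determined], a permutation can be recovered from [n + n] strings: the advice read in
    the order of the a-ports and in that of the b-ports. *)
Lemma loops_count n D k m S M (A : algorithm S M) (b : nat) :
  0 < k -> k.*2 <= D -> 0 < m -> D + m * k.*2 <= n ->
  (forall G : pgraph n, is_pgraph G -> has_diameter G D ->
     exists adv : 'I_n -> seq bool,
       (forall v, size (adv v) <= b) /\ recognizes_within A G adv (D + k)) ->
  m`! <= expn (expn 3 b) (n + n).
Proof.
move=> k0 kD m0 nD alg.
(* The [l] leaves pad the graph to [n] nodes; [d.+1 <= D] because [k > 0]. *)
pose d := D - k; pose l := n - (d.+1 + m * k.*2).
have kd : k <= d by rewrite /d; lia.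
have szE : size (loops_nodes k d l m) == n by rewrite size_loops_nodes /l /d; lia.
pose vs := Tuple szE.
have vsE : vs = loops_nodes k d l m :> seq _ by [].
pose ps (s : 'S_m) : seq nat := [seq val (s i) | i <- enum 'I_m].
have ps_perm s : perm_eq (ps s) (iota 0 m).
  apply: uniq_perm; rewrite ?iota_uniq //.
    by rewrite map_inj_uniq ?enum_uniq // => i j /val_inj /perm_inj.
  move=> i; rewrite mem_iota; apply/mapP/idP => [[j _ ->]|im]; first exact: ltn_ord.
  by exists (s^-1 (Ordinal im))%g; rewrite ?mem_enum // permKV.
have ps_inj : injective ps.
  move=> s s' /eq_in_map e; apply/permP => i; apply: val_inj; apply: e.
  by rewrite mem_enum.
have [adv advP] : exists adv : 'S_m -> 'I_n -> seq bool, forall s,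
    (forall v, size (adv s v) <= b) /\
    recognizes_within A (loops_graph k d l m vs (ps s)) (adv s) (D + k).
  apply: (fin_all_exists (P := fun s a => (forall v, size (a v) <= b) /\
    recognizes_within A (loops_graph k d l m vs (ps s)) a (D + k))) => s.
  have [pg dm] := loops_graph_ok k0 kd m0 vsE (ps_perm s).
  by apply: alg => //; move: dm; rewrite subnK //; lia.
have adv_size s u : size (advice_of vs (adv s) u) <= b.
  rewrite /advice_of; have [lt|ge] := ltnP (index u vs) n; last by rewrite nth_default // size_map size_enum_ord.
  by rewrite (nth_map (Ordinal lt)) ?size_enum_ord //; case: (advP s).
pose code (s : 'S_m) : {ffun 'I_n + 'I_n -> {ffun 'I_b -> option bool}} :=
  [ffun i => encode b (match i with
     | inl i => advice_of vs (adv s) (tnth vs i)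
     | inr i => advice_of vs (adv s) (relabel (ps s) (tnth vs i)) end)].
have code_inj : injective code.
  move=> s s' /ffunP e; apply: ps_inj.
  have [_ rec] := advP s; have [_ rec'] := advP s'.
  have T : D + k = d + k.*2 by rewrite /d; lia.
  rewrite T in rec rec'.
  apply: (loops_determined k0 kd m0 vsE (ps_perm s) (ps_perm s') rec rec').
  - move=> u /tnthP[i ->]; have := e (inl i); rewrite !ffunE.
    exact: encode_inj (adv_size _ _) (adv_size _ _).
  - move=> u /tnthP[i ->]; have := e (inr i); rewrite !ffunE.
    exact: encode_inj (adv_size _ _) (adv_size _ _).
have := leq_card code code_inj.
by rewrite card_Sn !card_ffun card_sum !card_ord card_option card_bool.
Qed.

(** * The bound *)

Lemma expn_le_fact_add q j : expn q j <= (q + j)`!.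
Proof.
elim: j => [|j IH]; first by rewrite expn0 fact_gt0.
by rewrite expnS addnS factS leq_mul // ltnW // ltnS leq_addr.
Qed.

Lemma leq_base a b j : a <= b -> expn a j <= expn b j.
Proof. by move=> ab; elim: j => // j IH; rewrite !expnS leq_mul. Qed.

(** With length 0 every assignment is constantly [[::]], and [D + k] is within the depth at which
    the two chains look alike. *)
Lemma no_empty_advice n D k S M (A : algorithm S M) :
  110 <= D -> D + 28 <= n -> k.*2 <= D ->
  ~ (forall G : pgraph n, is_pgraph G -> has_diameter G D ->
     exists adv : 'I_n -> seq bool,
       (forall v, size (adv v) <= 0) /\ recognizes_within A G adv (D + k)).
Proof.
move=> D110 Dn kD alg.
have TD : D + k <= D + D./2 by lia.
have [G [H [v [[pG dG] [pH dH] notiso runE]]]] := chain_ambiguous D110 Dn TD.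
have nil_adv (K : pgraph n) : is_pgraph K -> has_diameter K D ->
    recognizes_within A K (fun=> [::]) (D + k).
  move=> pK dK; have [adv [adv0 rec]] := alg K pK dK.
  suff <- : adv = fun=> [::] by [].
  by apply: functional_extensionality => i; apply: size0nil; apply/eqP; rewrite -leqn0.
by apply/notiso/(recognizes_iso (nil_adv _ pG dG) (nil_adv _ pH dH)) => r; exact: runE.
Qed.

(** * Real estimates *)

Lemma INR_expn a j : INR (expn a j) = (INR a ^ j)%R.
Proof.
elim: j => [|j IH]; first by rewrite expn0.
by rewrite expnS -multE mult_INR IH.
Qed.

Lemma INR_leq a b : a <= b -> (INR a <= INR b)%R.
Proof. by move=> /leP; exact: le_INR. Qed.

Lemma ln_expn a j : 0 < a -> ln (INR (expn a j)) = (INR j * ln (INR a))%R.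
Proof.
move=> a0; rewrite INR_expn ln_pow //; apply: lt_0_INR; exact/ltP.
Qed.

Open Scope R_scope.

Lemma ln_le_self x : 0 < x -> ln x <= x.
Proof.
move=> x0; have := exp_ineq1_le (ln x); rewrite exp_ln //; lra.
Qed.

Lemma ln_le_mono x y : 0 < x -> x <= y -> ln x <= ln y.
Proof. by move=> x0 [/(ln_increasing _ _ x0)|->]; lra. Qed.

(** From [K * K <= N] and [eps * N <= 8 * K * Q] follows [N <= Q ^ 4], hence [ln N <= 4 * ln Q].
    Multiplying the last two gives [eps * N * ln N <= 32 * K * (Q * ln Q)], and the bound on
    [Q * ln Q] yields the constant 128. *)
Lemma advice_bound (eps N K Q B : R) :
  0 < eps -> 1 <= K -> 4096 <= N * eps ^ 4 -> 64 <= N * eps ^ 2 -> K * K <= N ->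
  eps * N <= 4 * K * (Q + 1) -> 
  (1 <= Q -> Q * ln Q <= 4 * N * B * ln 2) ->
  eps / 128 * (ln N / ln 2) / K <= B.
Proof.
move=> e0 K1 N4 N2 KN Qe QB.
have ln2 := ln_lt_2.
have N0 : 0 < N by nra.
have eN : 8 * K <= eps * N.
  have : (8 * K) ^ 2 <= (eps * N) ^ 2.
    have : 64 * N <= (N * eps ^ 2) * N by apply: Rmult_le_compat_r; lra.
    by nra.
  move=> sq; apply: Rsqr_incr_0_var; rewrite /Rsqr; nra.
have Q8 : eps * N <= 8 * K * Q by lra.
have Q1 : 1 <= Q by nra.
have Qsq : eps ^ 2 * N <= 64 * Q ^ 2.
  have h : (eps * N) ^ 2 <= (8 * K * Q) ^ 2 by apply: pow_incr; split; [nra|].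
  have h2 : 64 * (K * K) * Q ^ 2 <= 64 * N * Q ^ 2.
    apply: Rmult_le_compat_r; nra.
  apply: (Rmult_le_reg_l N) => //; nra.
have Q4 : N <= Q ^ 4.
  have h : (eps ^ 2 * N) ^ 2 <= (64 * Q ^ 2) ^ 2 by apply: pow_incr; split; [nra|].
  have h2 : 4096 * N <= (N * eps ^ 4) * N by apply: Rmult_le_compat_r; lra.
  nra.
have lnQ : ln N <= 4 * ln Q.
  have := ln_le_mono N0 Q4; rewrite ln_pow; last by lra.
  by rewrite /= ; lra.
have lnQ0 : 0 <= ln Q by rewrite -ln_1; apply: ln_le_mono; lra.
have {}QB := QB Q1.
have h1 : eps * N * ln N <= 8 * K * Q * (4 * ln Q).
  have [lnN0|lnN0] := Rle_lt_dec 0 (ln N).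
    by apply: Rmult_le_compat => //; nra.
  have : 0 <= 8 * K * Q * (4 * ln Q) by apply: Rmult_le_pos; nra.
  have : 0 <= eps * N * - ln N by apply: Rmult_le_pos; nra.
  lra.
have h2 : eps * N * ln N <= 128 * K * B * ln 2 * N.
  apply: Rle_trans h1 _.
  have : 32 * K * (Q * ln Q) <= 32 * K * (4 * N * B * ln 2) by apply: Rmult_le_compat_l; lra.
  by nra.
have h3 : eps * ln N <= 128 * K * B * ln 2 by apply: (Rmult_le_reg_r N) => //; nra.
apply: (Rmult_le_reg_r (128 * K * ln 2)); first by nra.
have -> : eps / 128 * (ln N / ln 2) / K * (128 * K * ln 2) = eps * ln N by field; lra.
nra.
Qed.
Close Scope R_scope.

Theorem theorem4p2 (alpha : R) (Ha0 : (0 < alpha)%R) (Ha1 : (alpha < 1)%R) :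
  exists (c : R) (n0 : nat), (0 < c)%R /\
    forall (n D k : nat),
      n0 <= n -> 2 <= D -> (INR D <= alpha * INR n)%R ->
      0 < k -> k.*2 <= D ->
      forall (S M : Type) (A : algorithm S M) (b : nat),
        (forall G : pgraph n, is_pgraph G -> has_diameter G D ->
           exists adv : 'I_n -> seq bool,
             (forall v, size (adv v) <= b) /\ recognizes_within A G adv (D + k)) ->
        (c * log2R (INR n) / INR k <= INR b)%R.
Proof.
pose eps := (1 - alpha)%R.
have e0 : (0 < eps)%R by rewrite /eps; lra.
have e1 : (eps < 1)%R by rewrite /eps; lra.
have e4 : (0 < eps ^ 4)%R by apply: pow_lt.
(* Ample for the 4096 of [advice_bound], for [n >= 55 * 55] and for [n - D >= 28]. *)
have [n0 n0P] := INR_unbounded (20000 / eps ^ 4).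
exists (eps / 128)%R, n0; split; first by lra.
move=> n D k n0n D2 Dn k0 kD S M A b alg; rewrite /log2R.
have n4 : (20000 <= INR n * eps ^ 4)%R.
  have : (20000 / eps ^ 4 * eps ^ 4 <= INR n * eps ^ 4)%R.
    by apply: Rmult_le_compat_r; [lra|have := INR_leq n0n; lra].
  by rewrite /Rdiv Rmult_assoc Rinv_l; lra.
have eps2 : (eps ^ 2 <= 1)%R by nra.
have n2 : (20000 <= INR n * eps ^ 2)%R.
  have : (eps ^ 4 <= eps ^ 2)%R by nra.
  have := pos_INR n; nra.
have n1 : (20000 <= INR n * eps)%R by have := pos_INR n; nra.
have nn : (20000 <= INR n)%R by have := pos_INR n; nra.
have nDe : (eps * INR n <= INR n - INR D)%R by rewrite /eps; lra.
have k1 : (1 <= INR k)%R by have := INR_leq k0.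
have Dltn : D <= n by apply/leP; apply: INR_le; nra.
have nDE : INR (n - D) = (INR n - INR D)%R by rewrite -minusE minus_INR //; exact/leP.
have [nk|kn] := ltnP n (k * k).
  have b1 : 0 < b.
    rewrite lt0n; apply/negP => /eqP b0; rewrite b0 in alg.
    (* As [k * k > n], this gives [k >= 55] and so [D >= k.*2 >= 110]. *)
    have n55 : 55 * 55 <= n.
      by apply/leP; apply: INR_le; rewrite -multE mult_INR [INR 55]/=; lra.
    have k55 : 55 <= k by rewrite leqNgt; apply/negP => k54; have := leq_mul k54 k54; lia.
    have D110 : 110 <= D by lia.
    have Dn28 : D + 28 <= n.
      suff : 28 <= n - D by lia.
      by apply/leP; apply: INR_le; rewrite nDE [INR 28]/=; lra.
    exact: no_empty_advice alg.
  have NK : (INR n <= INR k * INR k)%R by rewrite -mult_INR multE; exact: INR_leq (ltnW nk).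
  (* Together with [ln 2 > 1 / 2] this gives log n at most [4 * k], so the claimed bound is at most
     [eps / 32], below 1. *)
  have lnN : (ln (INR n) <= 2 * INR k)%R.
    have n0' : (0 < INR n)%R by lra.
    have k0' : (0 < INR k)%R by lra.
    by have := ln_le_mono n0' NK; have := ln_le_self k0'; rewrite ln_mult //; lra.
  have ln2 := ln_lt_2.
  have lnN2 : (ln (INR n) / ln 2 <= 4 * INR k)%R.
    apply: (Rmult_le_reg_r (ln 2)); first lra.
    by rewrite /Rdiv Rmult_assoc Rinv_l; nra.
  apply: (Rle_trans _ 1); last by exact: (INR_leq b1).
  apply: (Rmult_le_reg_r (INR k)); first lra.
  by rewrite /Rdiv Rmult_assoc Rinv_l; nra.
(* There is room for [q.*2] loops of [k.*2] inner nodes, and the factorial of [q.*2] is at least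
   [q ^ q]. *)
pose q := (n - D) %/ (4 * k).
apply: (advice_bound (Q := INR q)) => //; try lra.
- by rewrite -mult_INR multE; exact: INR_leq kn.
- apply: (Rle_trans _ _ _ nDe); rewrite -nDE.
  have -> : (4 * INR k * (INR q + 1) = INR (4 * k * q.+1))%R.
    by rewrite -!multE !mult_INR (S_INR q) [INR 4]/=; lra.
  by apply: INR_leq; rewrite mulnC; apply/ltnW/ltn_ceil; lia.
move=> Q1.
have q0 : 0 < q by apply/ltP; apply: INR_lt; rewrite [INR 0]/=; lra.
have fact := @loops_count n D k q.*2 S M A b k0 kD ltac:(lia).
have room : D + q.*2 * k.*2 <= n.
  have h : q * (4 * k) <= n - D := leq_trunc_div _ _.
  move: q h {Q1 q0 fact} => q; rewrite -!muln2; nia.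
(* Weakening 3 to 4 makes the logarithm a multiple of [ln 2]. *)
have le1 : expn q q <= expn (expn 4 b) (n + n).
  apply: leq_trans (leq_trans (fact room alg) _); last exact/leq_base/leq_base.
  by rewrite -addnn expn_le_fact_add.
have N0 : (0 < INR (expn q q))%R by apply: lt_0_INR; apply/ltP; rewrite expn_gt0 q0.
have := ln_le_mono N0 (INR_leq le1).
rewrite !ln_expn ?expn_gt0 // -plusE plus_INR.
have -> : INR 4 = (2 * 2)%R by rewrite /=; lra.
rewrite ln_mult; lra.
Qed.
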